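(* Let $n\in\mathbb N_0$. Let $\mathcal P_e(n,2)$ (resp. $\mathcal P_o(n,2)$) be the set of partitions of $n$ having an even (resp. odd) number of even parts (counted with multiplicity), and let $\mathcal Q_o(n)$ be the set of partitions of $n$ into distinct odd parts. Then \[ \sum_{\lambda\in\mathcal P_e(n,2)}\ell(\lambda)\;-\;\sum_{\lambda\in\mathcal P_o(n,2)}\ell(\lambda)\;-\;\sum_{\lambda\in\mathcal Q_o(n)}\ell(\lambda) \] equals the number of partitions of $n$ in which exactly one even integer occurs as a part (possibly with multiplicity greater than one) and all other parts are odd and distinct.
   Context: A partition of $n\in\mathbb N_0$ is a non-increasing sequence of positive integers (parts) summing to $n$; the empty partition is the unique partition of $0$. $\ell(\lambda)$ denotes the number of parts of $\lambda$ counted with multiplicity. (The sets $\mathcal P_o(n,2)$ and $\mathcal Q_o(n)$ are disjoint.) *)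

(* Defs.v *)
From HB Require Import structures.
From mathcomp Require Import all_boot all_order all_algebra.

Set Implicit Arguments.
Unset Strict Implicit.
Unset Printing Implicit Defensive.

Definition is_partition (n : nat) (s : seq nat) : bool :=
  [&& sorted geq s, all (leq 1) s & sumn s == n].

Record partition_of (n : nat) := PartitionOf {
  parts :> seq nat;
  partsP : is_partition n parts
}.

HB.instance Definition _ n := [isSub for @parts n].
HB.instance Definition _ n := [Countable of partition_of n by <:].

(* Finiteness: a partition of n has at most n parts, each at most n. *)
Lemma size_le_sumn (s : seq nat) : all (leq 1) s -> size s <= sumn s.
Proof.
elim: s => //= x s IHs /andP[x_gt0 /IHs le_s].
by rewrite -add1n leq_add.
Qed.

Lemma mem_le_sumn (s : seq nat) (x : nat) : x \in s -> x <= sumn s.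
Proof.
elim: s => //= y s IHs; rewrite inE => /orP[/eqP-> | /IHs le_x].
  exact: leq_addr.
exact: leq_trans le_x (leq_addl _ _).
Qed.

Lemma size_partition_of n (l : partition_of n) :
  size (map (@inord n) l) <= n.
Proof.
rewrite size_map; case: l => s /= /and3P[_ s_gt0 /eqP def_n].
by rewrite -[X in _ <= X]def_n size_le_sumn.
Qed.

Definition bseq_of_partition n (l : partition_of n) : n.-bseq 'I_n.+1 :=
  Bseq (size_partition_of l).

Definition partition_of_bseq n (b : n.-bseq 'I_n.+1) : option (partition_of n) :=
  insub (map (@nat_of_ord n.+1) b).

Lemma bseq_of_partitionK n :
  pcancel (@bseq_of_partition n) (@partition_of_bseq n).
Proof.
move=> l; rewrite /partition_of_bseq /= -map_comp map_id_in ?valK //.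
move=> x x_l /=; rewrite inordK // ltnS.
by case: l x_l => s /= /and3P[_ _ /eqP<-]; apply: mem_le_sumn.
Qed.

HB.instance Definition _ n : isFinite (partition_of n) :=
  PCanIsFinite (@bseq_of_partitionK n).

Definition evenb (i : nat) : bool := ~~ odd i.

Definition Pe2 (n : nat) : {set partition_of n} :=
  [set l | ~~ odd (count evenb (parts l))].

Definition Po2 (n : nat) : {set partition_of n} :=
  [set l | odd (count evenb (parts l))].

Definition Qo (n : nat) : {set partition_of n} :=
  [set l | uniq (parts l) && all odd (parts l)].

(* undup discards multiplicities: exactly one even value occurs, any number
   of times, and the odd parts are pairwise distinct. *)
Definition one_even_value (n : nat) : {set partition_of n} :=
  [set l | (count evenb (undup (parts l)) == 1)
           && uniq (filter odd (parts l))].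

(* Main.v *)
(** Let [S n] be the number of partitions of [n] counted with the sign
    (-1)^(number of even parts), and [q n] the number of partitions of [n] into
    distinct odd parts.  Removing copies of a part [i] one at a time expresses
    each of the following as a sum, over the multiples [N = i m] of [i] with
    [0 < N <= n], of
    - [(-1)^(m [i even]) S (n - N)], for the signed number of occurrences of [i];
    - [- (-1)^m q (n - N)] with [i] odd, for the occurrences of [i] in
      partitions into distinct odd parts;
    - [q (n - N)] with [i] even, for the partitions with distinct odd parts
      whose only even value is [i].
    Summing over [i] with weight [i] gives recurrences for [n S n] and [n q n]
    whose divisor-sum coefficients agree, hence [S = q].  Summing over [i] with
    weight 1 gives the theorem, again by comparing divisor sums: for even [N],
    the involution [i |-> N / i] shows that [N] has as many odd divisors as
    divisors with odd cofactor. *)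

Require Import Defs.
From mathcomp Require Import all_boot all_order all_algebra.
From mathcomp Require Import zify.
Import GRing.Theory.
Local Open Scope ring_scope.

Set Implicit Arguments.
Unset Strict Implicit.
Unset Printing Implicit Defensive.

(** * Removing one copy of a part, and the recurrence this produces *)

Lemma geq_trans : transitive geq.
Proof. by move=> y x z /= yx zy; apply: leq_trans zy yx. Qed.

Lemma geq_total : total geq.
Proof. by move=> x y; apply: leq_total. Qed.

Lemma geq_anti : antisymmetric geq.
Proof. by move=> x y /= xy; apply/anti_leq; rewrite andbC. Qed.

Lemma is_partition_insert (i k : nat) (s : seq nat) :
  (0 < i)%N -> is_partition k s -> is_partition (i + k) (sort geq (i :: s)).
Proof.
move=> i_gt0 /and3P[_ s_gt0 /eqP <-].
have ps : perm_eq (sort geq (i :: s)) (i :: s) by rewrite perm_sort.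
apply/and3P; split; first exact: sort_sorted geq_total _.
  by rewrite (perm_all _ ps) /= i_gt0.
by rewrite (perm_sumn ps).
Qed.

Lemma is_partition_rem (i k : nat) (s : seq nat) :
  i \in s -> is_partition (i + k) s -> is_partition k (rem i s).
Proof.
move=> i_s /and3P[srt s_gt0 /eqP sum_s].
have sub := rem_subseq i s.
apply/and3P; split; first exact: subseq_sorted geq_trans _ _ sub srt.
  by apply/allP => x /(mem_subseq sub) /(allP s_gt0).
by move: sum_s; rewrite (perm_sumn (perm_to_rem i_s)) /= => /addnI ->.
Qed.

(** Inserting [i] and re-sorting is a bijection onto the partitions that contain [i]. Invariance of
    [F] under permutation absorbs the sorting. *)
Lemma sum_partition_mem (i k : nat) (F : seq nat -> int) :
  (0 < i)%N -> (forall s t, perm_eq s t -> F s = F t) ->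
  \sum_(l : partition_of (i + k) | i \in parts l) F l
  = \sum_(m : partition_of k) F (i :: m).
Proof.
move=> i_gt0 Fperm.
pose h (m : partition_of k) : partition_of (i + k) :=
  PartitionOf (is_partition_insert i_gt0 (partsP m)).
(* Removing [i] gives a partition of [k] only when [i] occurs, so the inverse is partial. *)
pose h' (l : partition_of (i + k)) : option (partition_of k) :=
  insub (rem i (parts l)).
have sortK (s : seq nat) : sorted geq s -> i \in s ->
    sort geq (i :: rem i s) = s.
  move=> srt i_s; apply: (sorted_eq geq_trans geq_anti) => //.
    exact: sort_sorted geq_total _.
  by rewrite perm_sort perm_sym perm_to_rem.
rewrite (reindex_omap h h') /=; last first.
  move=> l i_l; rewrite /h' insubT ?(is_partition_rem i_l (partsP l)) //= => rl.
  congr Some; apply: val_inj => /=.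
  by case/and3P: (partsP l) => srt _ _; apply: sortK.
apply: eq_big => [m|m _]; last by apply: Fperm; rewrite perm_sort.
have i_h : i \in sort geq (i :: m) by rewrite mem_sort mem_head.
rewrite i_h /h' insubT ?(is_partition_rem i_h) ?(partsP (h m)) // => rl.
apply/eqP; congr Some; apply: val_inj => /=.
case/and3P: (partsP m) => srt _ _; case/and3P: rl => srt' _ _.
apply: (sorted_eq geq_trans geq_anti) => //.
rewrite -(perm_cons i) perm_sym; apply: perm_trans (perm_to_rem i_h).
by rewrite perm_sym perm_sort.
Qed.

Lemma mem_partition_of (n : nat) (l : partition_of n) (x : nat) :
  x \in parts l -> (0 < x <= n)%N.
Proof.
case/and3P: (partsP l) => _ /allP l_gt0 /eqP sum_l x_l.
by rewrite l_gt0 // -sum_l mem_le_sumn.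
Qed.

Lemma sum_partition_large (i n : nat) (F : seq nat -> int) :
  (n < i)%N -> \sum_(l : partition_of n | i \in parts l) F l = 0.
Proof.
move=> n_lt_i; apply: big1 => l /mem_partition_of /andP[_].
by rewrite leqNgt n_lt_i.
Qed.

(* The generating function identity T = s q^i (U + T) solved for T. *)
Lemma geometric_recurrence (s : int) (i : nat) (T U : nat -> int) (n : nat) :
  (0 < i)%N -> (forall k, (k < i)%N -> T k = 0) ->
  (forall k, T (i + k)%N = s * (U k + T k)) ->
  T n = \sum_(1 <= N < n.+1 | (i %| N)%N) s ^+ (N %/ i) * U (n - N)%N.
Proof.
move=> i_gt0 T_small T_rec.
have [m] := ubnP n; elim: m n => // m IHm n; rewrite ltnS => n_le_m.
have [n_lt_i|i_le_n] := ltnP n i.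
  rewrite T_small // big_nat_cond big1 // => N /andP[N_n /(dvdn_leq _)]; lia.
have ->: n = (i + (n - i))%N by rewrite subnKC.
move: (n - i)%N (leq_sub2r i n_le_m) => k k_le.
rewrite T_rec IHm; last by lia.
(* No positive multiple of [i] lies below [i]; the term [N = i] gives [s * U k], and the rest,
   shifted by [i], is [s] times the formula for [T k]. *)
rewrite [RHS](@big_cat_nat _ _ _ i) /=; [|lia..].
rewrite [X in _ = X + _](_ : _ = 0) ?add0r; last first.
  by rewrite big_nat_cond big1 // => N /andP[N_i /(dvdn_leq _)]; lia.
rewrite [RHS]big_ltn_cond ?ltnS ?leq_addr //= dvdnn divnn i_gt0 expr1 addKn mulrDr.
congr (_ + _); rewrite -[i.+1]add1n -[(i + k).+1]addnS [RHS]big_addn.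
rewrite addKn big_distrr /=; apply: eq_big => [N|N iN]; first by rewrite dvdn_addl.
by rewrite divnDr // divnn i_gt0 addn1 exprS mulrA [(N + i)%N]addnC subnDl.
Qed.

(** * Counting the occurrences of a fixed part *)

Definition sgn_even (s : seq nat) : int := (-1) ^+ count evenb s.

Definition sgn_sum (n : nat) : int := \sum_(l : partition_of n) sgn_even l.

Definition oddset (s : seq nat) : bool := uniq s && all odd s.

Definition oddset_num (n : nat) : int :=
  \sum_(l : partition_of n) (oddset l)%:R.

Lemma big_mem_partition (n i : nat) (F : seq nat -> int) :
  (forall s, i \notin s -> F s = 0) ->
  \sum_(l : partition_of n) F l = \sum_(l : partition_of n | i \in parts l) F l.
Proof.
move=> F0; rewrite [LHS](bigID (fun l : partition_of n => i \in parts l)) /=.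
by rewrite [X in _ + X]big1 ?addr0 // => l /F0.
Qed.

(** Deleting one [i] lowers its multiplicity by one and changes the sign exactly when [i] is even,
    so [T (i + k) = s * (S k + T k)] with [s = (-1) ^+ evenb i]. *)
Lemma sgn_sum_count (i n : nat) : (0 < i)%N ->
  \sum_(l : partition_of n) sgn_even l * (count_mem i l)%:R
  = \sum_(1 <= N < n.+1 | (i %| N)%N)
      ((-1) ^+ evenb i) ^+ (N %/ i) * sgn_sum (n - N).
Proof.
move=> i_gt0; pose F s : int := sgn_even s * (count_mem i s)%:R.
have F0 s : i \notin s -> F s = 0.
  by move=> /count_memPn; rewrite /F => ->; rewrite mulr0.
pose T k := \sum_(l : partition_of k) F l.
apply: (@geometric_recurrence _ i T) => // [k k_i|k]; rewrite /T.
  by rewrite (big_mem_partition _ F0) sum_partition_large.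
rewrite (big_mem_partition _ F0) sum_partition_mem // => [|s t st].
  rewrite /sgn_sum -big_split big_distrr /=; apply: eq_bigr => m _.
  by rewrite /F /sgn_even /= eqxx exprD natrD -mulrA mulrDr mulr1.
by rewrite /F /sgn_even !(permP st).
Qed.

(** For odd [i], adjoining [i] keeps the parts distinct only if [i] was absent, so
    [T (i + k) = q k - T k]: the geometric recurrence with [s = -1] and [U = - q]. *)
Lemma oddset_sum_count (i n : nat) : (0 < i)%N ->
  \sum_(l : partition_of n) (oddset l)%:R * (count_mem i l)%:R
  = \sum_(1 <= N < n.+1 | (i %| N)%N)
      (if odd i then - (-1) ^+ (N %/ i) else 0) * oddset_num (n - N).
Proof.
move=> i_gt0; pose F s : int := (oddset s)%:R * (count_mem i s)%:R.
have F0 s : i \notin s -> F s = 0.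
  by move=> /count_memPn; rewrite /F => ->; rewrite mulr0.
have [odd_i|odd_i] := boolP (odd i); last first.
  rewrite [RHS]big1 => [|N _]; last by rewrite mul0r.
  apply: big1 => l _; rewrite -/(F l) /F /oddset; case: allP => [odd_l|]; last first.
    by rewrite andbF mul0r.
  by rewrite (count_memPn _) ?mulr0 //; apply: contra odd_i => /odd_l.
pose T k := \sum_(l : partition_of k) F l.
have := @geometric_recurrence (-1) i T (fun k => - oddset_num k) n i_gt0.
rewrite -/(T n) => ->; first by apply: eq_bigr => N _; rewrite mulrN mulNr.
- by move=> k k_i; rewrite /T (big_mem_partition _ F0) sum_partition_large.
- move=> k; rewrite /T (big_mem_partition _ F0) sum_partition_mem // => [|s t st].
    rewrite /oddset_num -sumrN -big_split big_distrr /=; apply: eq_bigr => m _.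
    rewrite /F /oddset /= eqxx odd_i /=.
    case: (boolP (uniq m)) => [um|]; last by rewrite andbF !mul0r oppr0 addr0 mulr0.
    rewrite count_uniq_mem // andbT; case: (i \in _); by case: all.
  by rewrite /F /oddset (permP st) (perm_uniq st) (perm_all _ st).
Qed.

Definition only_even (i : nat) (s : seq nat) : bool :=
  all (fun x => odd x || (x == i)) s && uniq (filter odd s).

(** After one [i] is deleted, either [i] still occurs or only distinct odd parts remain, so
    [T (i + k) = q k + T k]. *)
Lemma only_even_sum (i n : nat) : (0 < i)%N -> ~~ odd i ->
  \sum_(l : partition_of n) ((i \in parts l) && only_even i l)%:R
  = \sum_(1 <= N < n.+1 | (i %| N)%N) oddset_num (n - N).
Proof.
move=> i_gt0 even_i; pose F s : int := ((i \in s) && only_even i s)%:R.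
have F0 s : i \notin s -> F s = 0 by rewrite /F => /negbTE ->.
pose T k := \sum_(l : partition_of k) F l.
have := @geometric_recurrence 1 i T oddset_num n i_gt0.
rewrite -/(T n) => ->; first by apply: eq_bigr => N _; rewrite expr1n mul1r.
- by move=> k k_i; rewrite /T (big_mem_partition _ F0) sum_partition_large.
- move=> k; rewrite /T (big_mem_partition _ F0) sum_partition_mem // => [|s t st].
    rewrite mul1r /oddset_num -big_split /=; apply: eq_bigr => m _.
    rewrite /F inE eqxx /= /only_even /= eqxx orbT (negbTE even_i) /= /oddset.
    have [i_m|i_m] /= := boolP (i \in parts m).
      have ->: all odd m = false; last by rewrite andbF add0r.
      by apply/negP => /allP /(_ _ i_m); apply/negP.
    rewrite addr0 andbC; have ->: all (fun x => odd x || (x == i)) m = all odd m.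
      apply: eq_in_all => x x_m; case: eqP => [xi|]; last by rewrite orbF.
      by rewrite -xi x_m in i_m.
    by case: (boolP (all odd m)) => [/all_filterP -> //|]; rewrite !andbF.
  rewrite /F /only_even (perm_mem st) (perm_all _ st).
  by rewrite (perm_uniq (perm_filter odd st)).
Qed.

(** * From sums over parts to sums over divisors *)

Lemma big_seq_count (n : nat) (s : seq nat) (f : nat -> int) :
  {subset s <= index_iota 1 n.+1} ->
  \sum_(x <- s) f x = \sum_(1 <= i < n.+1) f i * (count_mem i s)%:R.
Proof.
elim: s => [|y s IHs] s_n.
  by rewrite big_nil big1 // => i _; rewrite mulr0.
rewrite big_cons IHs => [|x x_s]; last by apply: s_n; rewrite inE x_s orbT.
under [RHS]eq_bigr => i _ do rewrite /= natrD mulrDr.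
rewrite big_split /=; congr (_ + _).
rewrite (bigD1_seq y) ?iota_uniq ?s_n ?mem_head //= eqxx mulr1.
by rewrite big1 ?addr0 // => i /negbTE; rewrite eq_sym => ->; rewrite mulr0.
Qed.

Lemma big_parts (n : nat) (l : partition_of n) (f : nat -> int) :
  \sum_(x <- parts l) f x = \sum_(1 <= i < n.+1) f i * (count_mem i l)%:R.
Proof.
apply: big_seq_count => x x_l.
by rewrite mem_index_iota ltnS (mem_partition_of x_l).
Qed.

Lemma big_divisors (n N : nat) (f : nat -> int) : (0 < N <= n)%N ->
  \sum_(1 <= i < n.+1 | (i %| N)%N) f i = \sum_(i <- divisors N) f i.
Proof.
case/andP=> N_gt0 N_n; rewrite -big_filter; apply: perm_big.
apply: uniq_perm; rewrite ?filter_uniq ?iota_uniq ?divisors_uniq // => i.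
rewrite mem_filter mem_index_iota -dvdn_divisors //.
case: (boolP (i %| N)%N) => //= i_N; rewrite (dvdn_gt0 N_gt0) //=.
by rewrite ltnS (leq_trans (dvdn_leq N_gt0 i_N)).
Qed.

(** This merges the recurrences for the individual parts into a single one, whose coefficients are
    divisor sums. *)
Lemma exchange_divisors (n : nat) (c : nat -> nat -> int) (U : nat -> int) :
  \sum_(1 <= i < n.+1) \sum_(1 <= N < n.+1 | (i %| N)%N)
      c i (N %/ i)%N * U (n - N)%N
  = \sum_(1 <= N < n.+1)
      (\sum_(i <- divisors N) c i (N %/ i)%N) * U (n - N)%N.
Proof.
rewrite (exchange_big_dep predT) //= big_nat [RHS]big_nat.
by apply: eq_bigr => N N_n; rewrite big_divisors // big_distrl.
Qed.

(** * Identities between divisor sums *)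

Lemma divisors_even_sum (N : nat) (f : nat -> int) : (0 < N)%N ->
  \sum_(i <- divisors N.*2 | ~~ odd i) f i = \sum_(i <- divisors N) f i.*2.
Proof.
move=> N_gt0; rewrite -big_filter -(big_map double xpredT); apply: perm_big.
apply: uniq_perm; rewrite ?filter_uniq ?divisors_uniq //.
  by rewrite map_inj_uniq ?divisors_uniq //; apply: double_inj.
move=> i; rewrite mem_filter -dvdn_divisors ?double_gt0 //.
apply/andP/mapP => [[even_i]|[j]].
  have def_i : i = i./2.*2 by rewrite -[LHS]odd_double_half (negbTE even_i).
  rewrite def_i -!muln2 dvdn_pmul2r // => i_N; exists i./2; rewrite ?muln2 //.
  by rewrite -dvdn_divisors.
by rewrite -dvdn_divisors // => j_N ->; rewrite odd_double -!muln2 dvdn_pmul2r.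
Qed.

Lemma divisors_compl_sum (N : nat) (f : nat -> int) : (0 < N)%N ->
  \sum_(i <- divisors N) f (N %/ i)%N = \sum_(i <- divisors N) f i.
Proof.
move=> N_gt0; rewrite -(big_map (divn N) xpredT); apply: perm_big.
have invol i : i \in divisors N -> (N %/ (N %/ i))%N = i.
  by rewrite -dvdn_divisors // => i_N; rewrite divnA // mulKn.
have inv_in i : i \in divisors N -> (N %/ i)%N \in divisors N.
  by rewrite -!dvdn_divisors // => /dvdn_div.
apply: uniq_perm; rewrite ?divisors_uniq ?map_inj_in_uniq ?divisors_uniq //.
  by move=> i j /invol {2}<- /invol {2}<- ->.
move=> i; apply/mapP/idP => [[j /inv_in j_N ->] //|i_N].
by exists (N %/ i)%N; rewrite ?inv_in ?invol.
Qed.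

Lemma odd_divisor (N i : nat) : i \in divisors N -> odd N -> odd i && odd (N %/ i).
Proof.
move=> i_N odd_N; have N_gt0 : (0 < N)%N by case: N odd_N {i_N}.
move: i_N; rewrite -dvdn_divisors // => /divnK i_N.
by move: odd_N; rewrite -{1}i_N oddM andbC.
Qed.

Lemma odd_quotient (N i : nat) :
  i \in divisors N -> (0 < N)%N -> odd i -> odd (N %/ i) = odd N.
Proof.
move=> + N_gt0 odd_i; rewrite -dvdn_divisors // => /divnK {2}<-.
by rewrite oddM odd_i andbT.
Qed.

(** For odd [M] the terms cancel pairwise. For [M = 2K] the odd divisors are those of [K] and have
    even cofactor, while the even ones are the doubles of divisors of [K]; the total is twice the
    one for [K]. *)
Lemma divisor_sum_cancel (M : nat) : (0 < M)%N ->
  \sum_(i <- divisors M | odd i) (i%:R : int)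
  + \sum_(i <- divisors M) i%:R * (-1) ^+ (M %/ i) = 0.
Proof.
have [m] := ubnP M; elim: m M => // m IHm M M_m M_gt0.
have [odd_M|even_M] := boolP (odd M).
  rewrite big_mkcond -big_split /= big_seq big1 // => i i_M.
  have /andP[-> odd_Mi] := odd_divisor i_M odd_M.
  by rewrite -signr_odd odd_Mi mulrN1 subrr.
have [K def_M] : exists K, M = K.*2.
  by exists M./2; rewrite -[LHS]odd_double_half (negbTE even_M).
subst M; rewrite double_gt0 in M_gt0.
rewrite [X in _ + X](bigID odd) /= divisors_even_sum //.
have ->: \sum_(i <- divisors K.*2 | odd i) i%:R * (-1) ^+ (K.*2 %/ i)
         = \sum_(i <- divisors K.*2 | odd i) (i%:R : int).
  rewrite big_seq_cond [RHS]big_seq_cond; apply: eq_bigr => i /andP[i_M odd_i].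
  by rewrite -signr_odd (odd_quotient i_M) ?double_gt0 // odd_double mulr1.
have ->: \sum_(i <- divisors K.*2 | odd i) (i%:R : int)
         = \sum_(i <- divisors K | odd i) i%:R.
  rewrite -big_filter -[RHS]big_filter; apply: perm_big; apply: uniq_perm.
  - by rewrite filter_uniq ?divisors_uniq.
  - by rewrite filter_uniq ?divisors_uniq.
  move=> i; rewrite !mem_filter; case: (boolP (odd i)) => //= odd_i.
  by rewrite -!dvdn_divisors ?double_gt0 // -muln2 Gauss_dvdl // coprimen2.
have ->: \sum_(i <- divisors K) (i.*2)%:R * (-1) ^+ (K.*2 %/ i.*2)
         = 2 * \sum_(i <- divisors K) (i%:R : int) * (-1) ^+ (K %/ i).
  rewrite big_distrr /=; apply: eq_bigr => i _.
  by rewrite -!mul2n divnMl // natrM mulrA.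
rewrite addrA -mulr2n -[X in X + _]mulr_natl -mulrDr IHm ?mulr0 //; lia.
Qed.

Lemma sgn_oddset_divisors (N : nat) : (0 < N)%N ->
  \sum_(i <- divisors N) (i%:R : int) * ((-1) ^+ evenb i) ^+ (N %/ i)
  = \sum_(i <- divisors N) i%:R * (if odd i then - (-1) ^+ (N %/ i) else 0).
Proof.
move=> N_gt0; have [odd_N|even_N] := boolP (odd N).
  rewrite big_seq [RHS]big_seq; apply: eq_bigr => i i_N.
  have /andP[odd_i odd_Ni] := odd_divisor i_N odd_N.
  by rewrite /evenb odd_i expr1n -signr_odd odd_Ni opprK.
apply/eqP; rewrite -subr_eq0 -sumrB; apply/eqP.
(* For even [N] the two sides differ, term by term, by the vanishing sum: [2 i] for odd [i], and
   [i * (-1) ^+ (N %/ i)] for even [i]. *)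
rewrite -[RHS](divisor_sum_cancel N_gt0) [X in _ = X + _]big_mkcond -big_split /=.
rewrite big_seq [RHS]big_seq; apply: eq_bigr => i i_N.
rewrite /evenb; case: (boolP (odd i)) => odd_i /=; last by rewrite mulr0 subr0 add0r.
by rewrite expr1n -(signr_odd _ (N %/ i)) (odd_quotient i_N) // (negbTE even_N)
  mulrN opprK mulr1.
Qed.

Lemma length_divisors (N : nat) : (0 < N)%N ->
  \sum_(i <- divisors N) ((-1) ^+ evenb i) ^+ (N %/ i)
  - \sum_(i <- divisors N) (if odd i then - (-1) ^+ (N %/ i) else 0)
  = \sum_(i <- divisors N) (evenb i)%:R :> int.
Proof.
move=> N_gt0; have [odd_N|even_N] := boolP (odd N).
  rewrite -sumrB big_seq [RHS]big_seq; apply: eq_bigr => i i_N.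
  have /andP[odd_i odd_Ni] := odd_divisor i_N odd_N.
  by rewrite /evenb odd_i expr1n -signr_odd odd_Ni.
apply/eqP; rewrite -subr_eq0 -!sumrB; apply/eqP.
(* An odd [i] has even cofactor and contributes 2; an even [i] contributes -2 or 0 as its cofactor
   is odd or even. Complementary divisors then cancel. *)
transitivity (\sum_(i <- divisors N) 2 * ((odd i)%:R - (odd (N %/ i))%:R) : int).
  rewrite big_seq [RHS]big_seq; apply: eq_bigr => i i_N.
  rewrite /evenb; case: (boolP (odd i)) => odd_i /=.
    by rewrite expr1n -(signr_odd _ (N %/ i)) (odd_quotient i_N) // (negbTE even_N).
  by rewrite expr1 -signr_odd; case: odd.
by rewrite -big_distrr /= sumrB (divisors_compl_sum (fun i => (odd i)%:R)) // subrr mulr0.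
Qed.

(** * Weighted recurrences and the equality of the two counts *)

(** Used with [f i = i], where the inner sum is [n], and with [f i = 1], where it is the length. *)
Lemma sgn_sum_weighted (n : nat) (f : nat -> int) :
  \sum_(l : partition_of n) sgn_even l * \sum_(x <- parts l) f x
  = \sum_(1 <= N < n.+1)
      (\sum_(i <- divisors N) f i * ((-1) ^+ evenb i) ^+ (N %/ i))
      * sgn_sum (n - N).
Proof.
rewrite -(exchange_divisors _ (fun i m => f i * ((-1) ^+ evenb i) ^+ m)).
under eq_bigr => l _ do rewrite big_parts big_distrr.
rewrite exchange_big /= big_nat [RHS]big_nat; apply: eq_bigr => i /andP[i_gt0 _].
under [RHS]eq_bigr => N _ do rewrite -mulrA.
rewrite -big_distrr /= -sgn_sum_count // big_distrr /=.
by apply: eq_bigr => l _; rewrite mulrCA.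
Qed.

Lemma oddset_sum_weighted (n : nat) (f : nat -> int) :
  \sum_(l : partition_of n) (oddset l)%:R * \sum_(x <- parts l) f x
  = \sum_(1 <= N < n.+1)
      (\sum_(i <- divisors N) f i * (if odd i then - (-1) ^+ (N %/ i) else 0))
      * oddset_num (n - N).
Proof.
rewrite -(exchange_divisors _
  (fun i m => f i * (if odd i then - (-1) ^+ m else 0))).
under eq_bigr => l _ do rewrite big_parts big_distrr.
rewrite exchange_big /= big_nat [RHS]big_nat; apply: eq_bigr => i /andP[i_gt0 _].
under [RHS]eq_bigr => N _ do rewrite -mulrA.
rewrite -big_distrr /= -oddset_sum_count // big_distrr /=.
by apply: eq_bigr => l _; rewrite mulrCA.
Qed.

Lemma parts_sum (n : nat) (l : partition_of n) :
  \sum_(x <- parts l) (x%:R : int) = n%:R.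
Proof.
by case/and3P: (partsP l) => _ _ /eqP {2}<-; rewrite sumnE natr_sum.
Qed.

Lemma parts0 (l : partition_of 0) : parts l = [::].
Proof.
case/and3P: (partsP l) => _ + /eqP; case: (parts l) => //= x s /andP[].
by case: x.
Qed.

(* Both sides satisfy the recurrence obtained by weighting each partition of n
   with the sum n of its parts. *)
Lemma sgn_sum_oddset (n : nat) : sgn_sum n = oddset_num n.
Proof.
have [m] := ubnP n; elim: m n => // m IHm [_|n n_m].
  (* The case [n = 0] is separate because the factor [n] could not be cancelled there. *)
  by apply: eq_bigr => l _; rewrite parts0.
have n1_neq0 : n.+1%:R != 0 :> int by rewrite natz.
apply: (mulIf n1_neq0); rewrite /sgn_sum /oddset_num !big_distrl /=.
under eq_bigr => l _ do rewrite -(parts_sum l).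
under [RHS]eq_bigr => l _ do rewrite -(parts_sum l).
rewrite sgn_sum_weighted oddset_sum_weighted big_nat [RHS]big_nat.
apply: eq_bigr => N /andP[N_gt0 N_n].
by rewrite sgn_oddset_divisors // IHm //; lia.
Qed.

(** * Partitions with one even value, and the conclusion *)

(** A nonzero term forces [i] to be the sole even value of [l], so at most one term survives. *)
Lemma one_even_value_sum (n : nat) (l : partition_of n) :
  (l \in one_even_value n)%:R
  = \sum_(1 <= i < n.+1) (evenb i)%:R * ((i \in parts l) && only_even i l)%:R :> int.
Proof.
rewrite inE -size_filter.
have evU x : (x \in [seq y <- undup l | evenb y]) = evenb x && (x \in parts l).
  by rewrite mem_filter mem_undup.
have [size1|sizeN1] /= := boolP (size _ == 1)%N.
  case: [seq _ <- _ | _] size1 evU => [|y []] // _ evU.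
  have /andP[even_y y_l] : evenb y && (y \in parts l) by rewrite -evU mem_head.
  rewrite (bigD1_seq y) ?iota_uniq //=; last first.
    by rewrite mem_index_iota ltnS (mem_partition_of y_l).
  rewrite even_y y_l mul1r big1 ?addr0 => [|i i_y]; last first.
    case: (boolP (evenb i && (i \in parts l))); last first.
      by rewrite negb_and => /orP[] /negbTE ->; rewrite ?mul0r ?mulr0.
    by rewrite -evU inE (negbTE i_y).
  rewrite /only_even /=; have -> //: all (fun x => odd x || (x == y)) l.
  apply/allP => x x_l; have := evU x; rewrite inE x_l andbT => ->.
  by rewrite /evenb orbN.
rewrite big1 // => i _; case: (boolP (evenb i)) => even_i; last by rewrite mul0r.
case: (boolP (i \in parts l)) => i_l; last by rewrite mulr0.
rewrite /only_even /=; case: (boolP (all _ _)) => [/allP l_i|]; last by rewrite mulr0.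
case/negP: sizeN1; rewrite (@perm_size _ _ [:: i]) //.
apply: uniq_perm; rewrite ?filter_uniq ?undup_uniq // => x.
rewrite evU inE; apply/andP/eqP => [[even_x /l_i]|-> //].
by rewrite (negbTE even_x) => /eqP.
Qed.

Lemma card_one_even_value (n : nat) :
  #|one_even_value n|%:Z
  = \sum_(1 <= N < n.+1) (\sum_(i <- divisors N) (evenb i)%:R) * oddset_num (n - N).
Proof.
rewrite -(exchange_divisors _ (fun i _ => (evenb i)%:R)) -sum1_card -natz natr_sum.
rewrite big_mkcond /=.
under eq_bigr => l _.
  rewrite (_ : (if _ then _ else _) = (l \in one_even_value n)%:R);
    last by case: (l \in _).
  rewrite one_even_value_sum; over.
rewrite exchange_big /= big_nat [RHS]big_nat; apply: eq_bigr => i /andP[i_gt0 _].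
rewrite -!big_distrr /=; case: (boolP (evenb i)) => even_i; last by rewrite !mul0r.
by rewrite only_even_sum.
Qed.

Theorem theorem1p2 (n : nat) :
  \sum_(l in Pe2 n) (size (parts l))%:Z
  - \sum_(l in Po2 n) (size (parts l))%:Z
  - \sum_(l in Qo n) (size (parts l))%:Z
  = #|one_even_value n|%:Z.
Proof.
have size_sum (l : partition_of n) : (size l)%:Z = \sum_(x <- parts l) 1.
  by rewrite big_const_seq count_predT iter_addr_0 natz.
have ->: \sum_(l in Pe2 n) (size (parts l))%:Z
         - \sum_(l in Po2 n) (size (parts l))%:Z
       = \sum_(l : partition_of n) sgn_even l * \sum_(x <- parts l) 1.
  rewrite big_mkcond [X in _ - X]big_mkcond -sumrB; apply: eq_bigr => l _.
  rewrite !inE -size_sum /sgn_even -signr_odd.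
  by case: odd; rewrite /= ?mulN1r ?mul1r ?sub0r ?subr0.
have ->: \sum_(l in Qo n) (size (parts l))%:Z
       = \sum_(l : partition_of n) (oddset l)%:R * \sum_(x <- parts l) 1.
  rewrite big_mkcond; apply: eq_bigr => l _; rewrite inE -size_sum -/(oddset l).
  by case: oddset; rewrite ?mul1r ?mul0r.
rewrite sgn_sum_weighted oddset_sum_weighted card_one_even_value -sumrB.
rewrite big_nat [RHS]big_nat; apply: eq_bigr => N /andP[N_gt0 _].
(* With [S = q] all three sums carry the factor [q (n - N)], and only their divisor sums remain to
   be compared. *)
rewrite sgn_sum_oddset -mulrBl -length_divisors //.
by congr ((_ - _) * _); apply: eq_bigr => i _; rewrite mul1r.
Qed.
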